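(* Let $T$ and $S$ be trusses, let $M$ be a $(T,S)$-bimodule and let $N$ be a left $T$-module. (1) The heap $\mathrm{Hom}_T(M,N)$ is a left $S$-module with the action given by $$(x\triangleright\varphi)(m)=\varphi(m\triangleleft x),\qquad\text{for all }\varphi\in\mathrm{Hom}_T(M,N),\ m\in M,\ x\in S.$$ (2) The heap $\mathrm{Hom}_T(N,M)$ is a right $S$-module with the action given by $$(\varphi\triangleleft x)(n)=\varphi(n)\triangleleft x,\qquad\text{for all }\varphi\in\mathrm{Hom}_T(N,M),\ n\in N,\ x\in S.$$
   Context: A heap is a non-empty set $H$ with a ternary operation $[-,-,-]$ satisfying $[v,w,[x,y,z]]=[[v,w,x],y,z]$ and $[x,x,y]=y=[y,x,x]$; it is Abelian if $[x,y,z]=[z,y,x]$. A heap morphism is a function preserving the ternary operations. A truss is an Abelian heap $T$ with an associative binary operation (juxtaposition) satisfying $w[x,y,z]=[wx,wy,wz]$ and $[x,y,z]w=[xw,yw,zw]$. A left $T$-module is an Abelian heap $M$ with a map $T\times M\to M$, $(x,m)\mapsto x\triangleright m$, such that $(xy)\triangleright m=x\triangleright(y\triangleright m)$, $x\triangleright[m,m',m'']=[x\triangleright m,x\triangleright m',x\triangleright m'']$ and $[x,y,z]\triangleright m=[x\triangleright m,y\triangleright m,z\triangleright m]$. A right $S$-module is defined symmetrically with a map $(m,x)\mapsto m\triangleleft x$ satisfying $m\triangleleft(xy)=(m\triangleleft x)\triangleleft y$ and the two analogous distributive laws. A $(T,S)$-bimodule is an Abelian heap that is a left $T$-module and a right $S$-module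 with $x\triangleright(m\triangleleft y)=(x\triangleright m)\triangleleft y$ for all $x\in T$, $y\in S$ and all elements $m$. A morphism of left $T$-modules is a heap morphism $\varphi$ with $\varphi(x\triangleright m)=x\triangleright\varphi(m)$ for all $x\in T$ and all $m$; $\mathrm{Hom}_T(M,N)$ is the set of such morphisms $M\to N$, with the pointwise heap operation $[\varphi_1,\varphi_2,\varphi_3](m)=[\varphi_1(m),\varphi_2(m),\varphi_3(m)]$.
   Formalization: Since heaps are non-empty by definition while the sets Hom_T(M,N) and Hom_T(N,M) can be empty, the claim that each is an Abelian heap is made only when it is non-empty; the action, its formula and its laws are asserted in all cases. *)

(* Defs.v *)
From Corelib Require Import ssreflect.

Set Implicit Arguments.
Unset Strict Implicit.
Unset Printing Implicit Defensive.

Record is_heap (H : Type) (br : H -> H -> H -> H) : Prop := {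
  heap_nonempty : inhabited H;
  heap_assoc : forall v w x y z, br v w (br x y z) = br (br v w x) y z;
  heap_malcev_l : forall x y, br x x y = y;
  heap_malcev_r : forall x y, br y x x = y
}.

Record is_abelian_heap (H : Type) (br : H -> H -> H -> H) : Prop := {
  abelian_heap_heap : is_heap br;
  abelian_heap_comm : forall x y z, br x y z = br z y x
}.

Record abHeap : Type := {
  abHeap_sort :> Type;
  bracket : abHeap_sort -> abHeap_sort -> abHeap_sort -> abHeap_sort;
  bracketP : is_abelian_heap bracket
}.
Arguments bracket {_}.

Definition heap_morphism (H K : abHeap) (f : H -> K) : Prop :=
  forall x y z, f (bracket x y z) = bracket (f x) (f y) (f z).

Record truss : Type := {
  truss_heap :> abHeap;
  tmul : truss_heap -> truss_heap -> truss_heap;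
  tmulA : forall x y z, tmul x (tmul y z) = tmul (tmul x y) z;
  tmul_bracket_r : forall w x y z,
    tmul w (bracket x y z) = bracket (tmul w x) (tmul w y) (tmul w z);
  tmul_bracket_l : forall w x y z,
    tmul (bracket x y z) w = bracket (tmul x w) (tmul y w) (tmul z w)
}.
Arguments tmul {_}.

(* A left T-module is an Abelian heap together with a map satisfying these laws.
   They are stated for a bare ternary operation because Hom_T(M, N), which may
   be empty, need not be the carrier of an [abHeap]. *)
Record is_left_action (T : truss) (M : Type) (br : M -> M -> M -> M)
    (act : T -> M -> M) : Prop := {
  left_actionA : forall x y m, act (tmul x y) m = act x (act y m);
  left_action_bracket_r : forall x m m' m'',
    act x (br m m' m'') = br (act x m) (act x m') (act x m'');
  left_action_bracket_l : forall x y z m,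
    act (bracket x y z) m = br (act x m) (act y m) (act z m)
}.

Record is_right_action (S : truss) (M : Type) (br : M -> M -> M -> M)
    (act : M -> S -> M) : Prop := {
  right_actionA : forall m x y, act m (tmul x y) = act (act m x) y;
  right_action_bracket_l : forall m m' m'' x,
    act (br m m' m'') x = br (act m x) (act m' x) (act m'' x);
  right_action_bracket_r : forall m x y z,
    act m (bracket x y z) = br (act m x) (act m y) (act m z)
}.

Record left_module (T : truss) : Type := {
  left_module_heap :> abHeap;
  lact : T -> left_module_heap -> left_module_heap;
  lactP : is_left_action bracket lact
}.
Arguments lact {_ _}.

Record bimodule (T S : truss) : Type := {
  bimodule_left :> left_module T;
  ract : bimodule_left -> S -> bimodule_left;
  ractP : is_right_action bracket ract;
  lract_comm : forall x m y, lact x (ract m y) = ract (lact x m) y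
}.
Arguments ract {_ _ _}.

Record hom (T : truss) (M N : left_module T) : Type := {
  hom_fun :> M -> N;
  hom_heap_morphism : heap_morphism hom_fun;
  hom_lact : forall x m, hom_fun (lact x m) = lact x (hom_fun m)
}.

Section HomBracket.

Variables (T : truss) (M N : left_module T).

Lemma bracket_medial (H : abHeap) (a1 a2 a3 b1 b2 b3 c1 c2 c3 : H) :
  bracket (bracket a1 a2 a3) (bracket b1 b2 b3) (bracket c1 c2 c3) =
  bracket (bracket a1 b1 c1) (bracket a2 b2 c2) (bracket a3 b3 c3).
Proof.
case: (bracketP H) => -[_ A ml mr] C.
have inv (x a b c y : H) :
    bracket x (bracket a b c) y = bracket (bracket x c b) a y.
  have e : bracket (bracket x c b) a (bracket a b c) = x.
    by rewrite A mr -A ml mr.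
  by rewrite -[in LHS]e -A ml.
have swap_neg (x a b c d : H) :
    bracket (bracket x a b) c d = bracket (bracket x c b) a d.
  by rewrite -inv [bracket c b a]C inv.
have swap_pos (x a b c d : H) :
    bracket (bracket x a b) c d = bracket (bracket x a d) c b.
  by rewrite -!A [bracket b c d]C.
rewrite !inv !A.
rewrite [in RHS](swap_pos a1 b1 c1 c2 b2) [in RHS](swap_pos _ c2 c1 a2 a3).
rewrite [in RHS](swap_pos a1 b1 b2 c2 a3).
rewrite [in RHS](swap_neg _ c2 b2 a2 c1) [in RHS](swap_neg a1 b1 a3 a2 b2).
by rewrite [in RHS](swap_neg _ c2 c1 b3 c3) [in RHS](swap_neg _ b1 b2 b3 c1).
Qed.

Lemma hom_bracket_heap_morphism (f g h : hom M N) :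
  heap_morphism (fun m => bracket (f m) (g m) (h m)).
Proof. by move=> x y z; rewrite !hom_heap_morphism bracket_medial. Qed.

Lemma hom_bracket_lact (f g h : hom M N) (x : T) (m : M) :
  bracket (f (lact x m)) (g (lact x m)) (h (lact x m)) =
  lact x (bracket (f m) (g m) (h m)).
Proof. by rewrite !hom_lact (left_action_bracket_r (@lactP T N)). Qed.

Definition hom_bracket (f g h : hom M N) : hom M N :=
  {| hom_fun := fun m => bracket (f m) (g m) (h m);
     hom_heap_morphism := hom_bracket_heap_morphism f g h;
     hom_lact := hom_bracket_lact f g h |}.

End HomBracket.

(* Main.v *)
From Corelib Require Import ssreflect.
From Stdlib Require Import FunctionalExtensionality ProofIrrelevance.
Require Import Defs.

(** A morphism is determined by its values, so every law on a Hom heap can be checked pointwise. For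
    each [x] in [S], the map [m ↦ m ◁ x] is an endomorphism of the left [T]-module [M]: the right
    action distributes over brackets, and it commutes with the [T]-action by the bimodule law. Part
    (1) precomposes with this endomorphism ([precomp_ractP]) and part (2) postcomposes
    ([postcomp_ractP]). *)

Lemma hom_ext (T : truss) (M N : left_module T) (f g : hom M N) :
  (forall m, f m = g m) -> f = g.
Proof.
case: f g => [f fH fT] [g gH gT] /= /functional_extensionality fg.
by subst g; rewrite (proof_irrelevance _ fH gH) (proof_irrelevance _ fT gT).
Qed.

(** The identities are inherited pointwise from [N]. Inhabitation is assumed because a heap is
    non-empty, whereas a Hom set may be empty. *)
Lemma hom_bracket_abelian_heap (T : truss) (M N : left_module T) :
  inhabited (hom M N) -> is_abelian_heap (@hom_bracket T M N).
Proof.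
case: (bracketP N) => -[_ A ml mr] C inh.
split; last by move=> f g h; apply: hom_ext => m; apply: C.
split=> // *; apply: hom_ext => m; [exact: A | exact: ml | exact: mr].
Qed.

Section PrecompositionAction.

Variables (T S : truss) (M : bimodule T S) (N : left_module T).

Lemma precomp_ract_heap_morphism (x : S) (f : hom M N) :
  heap_morphism (fun m : M => f (ract m x)).
Proof.
move=> a b c.
by rewrite (right_action_bracket_l (@ractP T S M)) hom_heap_morphism.
Qed.

Lemma precomp_ract_lact (x : S) (f : hom M N) (t : T) (m : M) :
  f (ract (lact t m) x) = lact t (f (ract m x)).
Proof. by rewrite -lract_comm hom_lact. Qed.

Definition precomp_ract (x : S) (f : hom M N) : hom M N :=
  {| hom_fun := fun m : M => f (ract m x);
     hom_heap_morphism := precomp_ract_heap_morphism x f;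
     hom_lact := precomp_ract_lact x f |}.

(** Precomposition reverses order, which turns the right action on [M] into a left one: [φ(m ◁ (xy))
    = φ((m ◁ x) ◁ y) = (y ▷ φ)(m ◁ x) = (x ▷ (y ▷ φ))(m)]. *)
Lemma precomp_ractP : is_left_action (@hom_bracket T M N) precomp_ract.
Proof.
split.
- by move=> x y f; apply: hom_ext => m /=; rewrite (right_actionA (@ractP T S M)).
(* Both sides compute to the same bracket of values at [ract m x]. *)
- by move=> x f g h; apply: hom_ext.
(* A bracket in [S] becomes a bracket in [M], which [f] then preserves. *)
- move=> x y z f; apply: hom_ext => m /=.
  by rewrite (right_action_bracket_r (@ractP T S M)) hom_heap_morphism.
Qed.

End PrecompositionAction.

Section PostcompositionAction.

Variables (T S : truss) (M : bimodule T S) (N : left_module T).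

Lemma postcomp_ract_heap_morphism (f : hom N M) (x : S) :
  heap_morphism (fun n : N => ract (f n) x).
Proof.
move=> a b c.
by rewrite hom_heap_morphism (right_action_bracket_l (@ractP T S M)).
Qed.

Lemma postcomp_ract_lact (f : hom N M) (x : S) (t : T) (n : N) :
  ract (f (lact t n)) x = lact t (ract (f n) x).
Proof. by rewrite hom_lact lract_comm. Qed.

Definition postcomp_ract (f : hom N M) (x : S) : hom N M :=
  {| hom_fun := fun n : N => ract (f n) x;
     hom_heap_morphism := postcomp_ract_heap_morphism f x;
     hom_lact := postcomp_ract_lact f x |}.

(** Postcomposition keeps the order, so each law is the same law of [M] taken at values of the
    morphisms. *)
Lemma postcomp_ractP : is_right_action (@hom_bracket T N M) postcomp_ract.
Proof.
split=> *; apply: hom_ext => n /=.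
- exact: (right_actionA (@ractP T S M)).
- exact: (right_action_bracket_l (@ractP T S M)).
- exact: (right_action_bracket_r (@ractP T S M)).
Qed.

End PostcompositionAction.

Theorem proposition4p14 (T S : truss) (M : bimodule T S) (N : left_module T) :
  ((inhabited (hom M N) -> is_abelian_heap (@hom_bracket T M N)) /\
   exists act : S -> hom M N -> hom M N,
     (forall (x : S) (phi : hom M N) (m : M), act x phi m = phi (ract m x)) /\
     is_left_action (@hom_bracket T M N) act) /\
  ((inhabited (hom N M) -> is_abelian_heap (@hom_bracket T N M)) /\
   exists act : hom N M -> S -> hom N M,
     (forall (phi : hom N M) (x : S) (n : N), act phi x n = ract (phi n) x) /\
     is_right_action (@hom_bracket T N M) act).
Proof.
split; split; try exact: hom_bracket_abelian_heap.
- by exists (@precomp_ract T S M N); split=> //; apply: precomp_ractP.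
- by exists (@postcomp_ract T S M N); split=> //; apply: postcomp_ractP.
Qed.
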